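(* Every first countable $C_s$-space is regular.
   Context: All topological spaces are Hausdorff. $\overline{A}$ denotes closure and $A^\circ$ interior. A mapping $f:F\to E$ is nearly continuous if $f^{-1}(V)\subseteq \left(\overline{f^{-1}(V)}\right)^\circ$ for every open $V\subseteq E$. It is separating if for any $x,y\in E$ with $x\neq y$ there exist neighborhoods $V_x$ of $x$ and $V_y$ of $y$ in $E$ such that $\overline{f^{-1}(V_x)}\cap f^{-1}(V_y)=\emptyset=f^{-1}(V_x)\cap\overline{f^{-1}(V_y)}$. A Hausdorff space $E$ is a $C_s$-space if for every Hausdorff space $F$, every nearly continuous separating mapping $f:F\to E$ is continuous. *)

(* Defs.v *)
From mathcomp Require Import all_boot.
From mathcomp Require Import all_classical topology.

Set Implicit Arguments.
Unset Strict Implicit.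
Unset Printing Implicit Defensive.

Local Open Scope classical_set_scope.

Definition nearly_continuous (F E : topologicalType) (f : F -> E) : Prop :=
  forall V : set E, open V -> f @^-1` V `<=` (closure (f @^-1` V))°.

Definition separating (F E : topologicalType) (f : F -> E) : Prop :=
  forall x y : E, x <> y ->
    exists Vx Vy : set E,
      [/\ nbhs x Vx, nbhs y Vy,
          closure (f @^-1` Vx) `&` f @^-1` Vy = set0 &
          f @^-1` Vx `&` closure (f @^-1` Vy) = set0].

Definition Cs_space (E : topologicalType) : Prop :=
  hausdorff_space E /\
  forall (F : topologicalType) (f : F -> E),
    hausdorff_space F -> nearly_continuous f -> separating f -> continuous f.

Definition first_countable (E : topologicalType) : Prop :=
  forall x : E, exists B : set (set E),
    [/\ countable B, B `<=` nbhs x &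
        forall A : set E, nbhs x A -> exists2 U : set E, B U & U `<=` A].

(* Main.v *)
Require Import Defs.
From HB Require Import structures.
From mathcomp Require Import all_boot.
From mathcomp Require Import all_classical topology.

(** The regularity of a C_s-space [E] at a point [p] follows from the continuity
at [p] of one nearly continuous separating map, namely the identity of [E] from a new
topology that is built around a base [C] of neighbourhoods of [p] which is a
chain for inclusion.

In the new topology the closures (for [E]) of the members of [C] are the basic
neighbourhoods of [p].  To make them open, each point [x] gets as
neighbourhoods the sets that contain [x] and the trace on [A] of some
neighbourhood of [x], where [A] is any member of [C] adherent to [x].  The
space so obtained has the following properties.
- Away from [p] it is finer than [E], and [p] can still be separated from any
  other point, because an open set of [E] disjoint from [A] is disjoint from
  [closure A].  So it is Hausdorff and the identity is separating
  ([retopologized_hausdorff], [separating_id_retopologized]).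
- A member [A] of [C] is dense in [closure A] even for the new topology, and
  [closure A] is a new neighbourhood of [p], so the identity is nearly continuous at [p]
  ([nearly_continuous_id_retopologized]).
- Continuity of the identity at [p] says that each neighbourhood of [p] in [E]
  contains [closure A] for some [A] in [C]: this is regularity at [p].

First countability enters only to produce such a chain
([first_countable_nested_base]). *)

Set Implicit Arguments.
Unset Strict Implicit.
Unset Printing Implicit Defensive.

Local Open Scope classical_set_scope.

(** The chain condition is what makes [retopology_open] below stable under
intersection; a general base is directed, but the members adherent to a given
point need not be.  The member [setT] ensures that each point of the space is
adherent to some member of [C]. *)
Definition nested_base (E : topologicalType) (p : E) (C : set (set E)) : Prop :=
  [/\ C setT, C `<=` nbhs p,
      forall U, nbhs p U -> exists2 A, C A & A `<=` U &
      forall A B, C A -> C B -> A `<=` B \/ B `<=` A].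

Lemma first_countable_nested_base (E : topologicalType) (p : E) :
  first_countable E -> exists C, nested_base p C.
Proof.
move=> /(_ p)[B [cB Bp Bbase]].
have [B0|/unsquash g] := pfcard_geP cB.
  by have [U] := Bbase _ filterT; rewrite B0.
pose V n := iteri n (fun i A => A `&` g i) setT.
have Vnbhs n : nbhs p (V n).
  elim: n => [|n IHn]; first exact: filterT.
  by apply: filterI IHn _; apply: Bp; apply: funS.
have Vdecr m n : m <= n -> V n `<=` V m.
  elim: n => [|n IHn]; first by rewrite leqn0 => /eqP ->.
  rewrite leq_eqVlt => /predU1P[-> //|/IHn VV].
  by move=> x [Vx _]; apply: VV.
exists (range V); split.
- by exists 0.
- by move=> _ [n _ <-].
- move=> U /Bbase[A /(@surj _ _ _ _ g)[n _ <-] AU].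
  by exists (V n.+1); [exists n.+1|move=> x [_ /AU]].
- move=> _ _ [m _ <-] [n _ <-].
  by have [/Vdecr|/ltnW/Vdecr] := leqP m n; [right|left].
Qed.

(** The case [x = p] of the second clause adds nothing to the first one, since
[closure A] contains the trace on [A] of the whole space. *)
Definition retopology_open (E : topologicalType) (p : E) (C : set (set E))
    (W : set E) : Prop :=
  (W p -> exists2 A, C A & closure A `<=` W) /\
  (forall x, W x -> exists N A,
     [/\ nbhs x N, C A, closure A x & N `&` A `<=` W]).

Section Retopology.
Context (E : topologicalType) (p : E) (C : set (set E)) (hC : nested_base p C).

Lemma retopology_openT : retopology_open p C setT.
Proof.
have [CT _ _ _] := hC.
split=> [_|x _]; first by exists setT.
by exists setT, setT; split=> //; [exact: filterT|rewrite closureT].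
Qed.

Lemma retopology_openI : setI_closed (retopology_open p C).
Proof.
have [_ _ _ chain] := hC.
move=> W1 W2 [Wp1 Wx1] [Wp2 Wx2]; split.
  move=> [/Wp1[A1 C1 s1] /Wp2[A2 C2 s2]].
  have [s|s] := chain _ _ C1 C2.
    by exists A1 => // x Ax; split; [exact: s1|apply: s2; exact: closureS Ax].
  by exists A2 => // x Ax; split; [apply: s1; exact: closureS Ax|exact: s2].
move=> x [/Wx1[N1 [A1 [n1 C1 c1 s1]]] /Wx2[N2 [A2 [n2 C2 c2 s2]]]].
(* The smaller of the two members of the chain is still adherent to [x]. *)
have [s|s] := chain _ _ C1 C2.
  exists (N1 `&` N2), A1; split=> //; first exact: filterI.
  by move=> y [[y1 y2] yA]; split; [exact: s1|apply: s2; split=> //; exact: s].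
exists (N1 `&` N2), A2; split=> //; first exact: filterI.
by move=> y [[y1 y2] yA]; split; [apply: s1; split=> //; exact: s|exact: s2].
Qed.

Lemma retopology_open_bigU (I : Type) (W : I -> set E) :
  (forall i, retopology_open p C (W i)) ->
  retopology_open p C (\bigcup_i W i).
Proof.
move=> Wop; split=> [[i _ /(proj1 (Wop i))[A CA sA]]|x [i _ Wx]].
  by exists A => // x /sA; exists i.
have [N [A [nN CA cA sA]]] := proj2 (Wop i) _ Wx.
by exists N, A; split=> // y /sA; exists i.
Qed.

Lemma retopology_open_closure A : C A -> retopology_open p C (closure A).
Proof.
move=> CA; split=> [_|x Ax]; first by exists A.
exists setT, A; split=> //; first exact: filterT.
by move=> y [_]; apply: subset_closure.
Qed.

Lemma retopology_open_notin V : open V -> ~ V p -> retopology_open p C V.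
Proof.
have [CT _ _ _] := hC.
move=> oV nVp; split=> // x Vx; exists V, setT; split=> //.
- exact: open_nbhs_nbhs.
- by rewrite closureT.
Qed.

End Retopology.

(** The proof argument is what provides the topology on this copy of [E]. *)
Definition retopologized (E : topologicalType) (p : E) (C : set (set E))
  (hC : nested_base p C) : Type := E.

HB.instance Definition _ (E : topologicalType) (p : E) (C : set (set E))
  (hC : nested_base p C) := Choice.copy (retopologized hC) E.

HB.instance Definition _ (E : topologicalType) (p : E) (C : set (set E))
    (hC : nested_base p C) :=
  isOpenTopological.Build (retopologized hC) (retopology_openT hC)
    (retopology_openI hC) (@retopology_open_bigU E p C).

Lemma hausdorff_open_disjoint (T : topologicalType) (x y : T) :
  hausdorff_space T -> x <> y -> exists V W : set T,
    [/\ open V, open W, V x, W y & V `&` W = set0].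
Proof.
rewrite open_hausdorff => hT /eqP /hT[[V W] /=]; rewrite !inE.
by move=> [Vx Wy] [oV oW VW]; exists V, W; split=> //; apply/eqP.
Qed.

Section IdentityFromRetopologized.
Context (E : topologicalType) (p : E) (C : set (set E)) (hC : nested_base p C).
Context (hE : hausdorff_space E).

Let F : topologicalType := retopologized hC.
Let f : F -> E := id.

(** Separate [x] from [p] by open sets and take [A] inside the one around [p]:
an open set disjoint from [A] is disjoint from [closure A]. *)
Lemma separated_from_closure (x : E) : x <> p ->
  exists V A, [/\ open V, V x, C A, ~ V p & V `&` closure A = set0].
Proof.
have [_ Cp Cbase _] := hC.
move=> /(hausdorff_open_disjoint hE)[V [U [oV oU Vx Up VU]]].
have [A CA AU] := Cbase _ (open_nbhs_nbhs (conj oU Up)).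
have VA : V `&` closure A = set0.
  rewrite -subset0 => y [Vy /(_ V (open_nbhs_nbhs (conj oV Vy)))[z [Az Vz]]].
  suff : set0 z by [].
  by rewrite -VU; split=> //; exact: AU.
exists V, A; split=> // Vp.
suff : set0 p by [].
by rewrite -VU; split.
Qed.

Lemma retopologized_open_nbhs (W : set E) (x : E) :
  retopology_open p C W -> W x -> nbhs (x : F) (W : set F).
Proof. by move=> oW Wx; apply: open_nbhs_nbhs; split. Qed.

Lemma closure_retopologized_open_disjoint (A V : set E) :
  retopology_open p C V -> A `&` V = set0 ->
  closure (A : set F) `&` V = set0.
Proof.
move=> oV AV; rewrite -subset0 => y [/(_ V) Ay Vy].
by have [z] := Ay (retopologized_open_nbhs oV Vy); rewrite AV.
Qed.

Lemma retopology_separated (x y : E) : x <> y -> exists V W,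
  [/\ V x, W y, nbhs x V /\ nbhs y W,
      retopology_open p C V /\ retopology_open p C W & V `&` W = set0].
Proof.
have [_ Cp _ _] := hC.
(* The two points play symmetric roles; put [p], if present, second. *)
wlog xp : x y / x <> p.
  move=> wl xy; have [xp|xp] := pselect (x = p); last exact: wl.
  have [V [W [Vy Wx [nV nW] [oV oW] VW]]] : exists V W,
      [/\ V y, W x, nbhs y V /\ nbhs x W,
          retopology_open p C V /\ retopology_open p C W & V `&` W = set0].
    by apply: wl => [yp|yx]; apply: xy; [rewrite xp yp|rewrite yx].
  by exists W, V; split; rewrite // setIC.
have [V [A [oV Vx CA nVp VA]]] := separated_from_closure xp.
have [->|yp] := pselect (y = p); move=> xy.
  exists V, (closure A); split=> //.
  - exact: subset_closure (nbhs_singleton (Cp _ CA)).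
  - split; first exact: open_nbhs_nbhs.
    by apply: filterS (Cp _ CA); exact: subset_closure.
  - by split; [exact: retopology_open_notin|exact: retopology_open_closure].
have [W [_ [oW Wy _ nWp _]]] := separated_from_closure yp.
have [V' [W' [oV' oW' V'x W'y VW']]] := hausdorff_open_disjoint hE xy.
have oVI := openI oV oV'; have oWI := openI oW oW'.
exists (V `&` V'), (W `&` W'); split.
- by split.
- by split.
- by split; apply: open_nbhs_nbhs; split.
- by split; apply: retopology_open_notin => // -[].
- by rewrite setIACA VW' setI0.
Qed.

Lemma retopologized_hausdorff : hausdorff_space F.
Proof.
rewrite open_hausdorff => x y /eqP /retopology_separated.
move=> [V [W [Vx Wy _ [oV oW] VW]]].
by exists (V, W); [rewrite /= !inE|split=> //; exact/eqP].
Qed.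

Lemma separating_id_retopologized : separating f.
Proof.
move=> x y /retopology_separated[V [W [_ _ [nV nW] [oV oW] VW]]].
exists V, W; split=> //; first exact: closure_retopologized_open_disjoint.
rewrite setIC; apply: closure_retopologized_open_disjoint => //.
by rewrite setIC.
Qed.

(** Near [x] adherent to both [A] and [B], the trace on [B] of a neighbourhood
of [x] meets [A], because one of [A] and [B] contains the other. *)
Lemma closure_sub_closure_retopologized (A : set E) :
  C A -> closure A `<=` closure (A : set F).
Proof.
have [_ _ _ chain] := hC.
move=> CA x cA W; rewrite nbhsE => -[U [oU Ux] UW].
have [N [B [nN CB cB NB]]] := proj2 oU x Ux.
have [s|s] := chain _ _ CA CB.
  have [z [Az Nz]] := cA _ nN.
  by exists z; split=> //; apply/UW/NB; split=> //; exact: s.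
have [z [Bz Nz]] := cB _ nN.
by exists z; split; [exact: s|apply/UW/NB].
Qed.

Lemma nearly_continuous_id_retopologized : nearly_continuous f.
Proof.
have [_ Cp Cbase _] := hC.
move=> V oV x Vx; have [xp|xp] := pselect (x = p).
  have [A CA AV] : exists2 A, C A & A `<=` V.
    by apply: Cbase; rewrite -xp; exact: open_nbhs_nbhs.
  apply: (@filterS F (nbhs (x : F)) _ (closure A)); last first.
    apply: retopologized_open_nbhs; first exact: retopology_open_closure.
    by rewrite xp; exact: subset_closure (nbhs_singleton (Cp _ CA)).
  apply: subset_trans (closure_sub_closure_retopologized CA) _.
  exact: (@closureS F).
have [U [_ [oU Ux _ nUp _]]] := separated_from_closure xp.
apply: (@filterS F (nbhs (x : F)) _ (V `&` U)).
  by move=> y [Vy _]; exact: (@subset_closure F).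
apply: retopologized_open_nbhs => //.
by apply: retopology_open_notin => //; [exact: openI|case].
Qed.

Lemma closure_base_of_continuous_id : {for p, continuous f} ->
  forall U, nbhs p U -> exists2 A, C A & closure A `<=` U.
Proof.
move=> fc U /fc pU.
have : nbhs (p : F) (U : set F) by [].
rewrite nbhsE => -[W [oW Wp] WU].
by have [A CA AW] := proj1 oW Wp; exists A => // x /AW/WU.
Qed.

End IdentityFromRetopologized.

Theorem proposition21 (E : topologicalType) :
  first_countable E -> Cs_space E -> regular_space E.
Proof.
move=> fcE [hE CsE] p U pU.
have [C hC] := first_countable_nested_base p fcE.
have [_ Cp _ _] := hC.
have idc := CsE _ _ (@retopologized_hausdorff _ _ _ hC hE)
  (@nearly_continuous_id_retopologized _ _ _ hC hE)
  (@separating_id_retopologized _ _ _ hC hE).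
have [A CA AU] := closure_base_of_continuous_id (idc p) pU.
by exists A => //; exact: Cp.
Qed.
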